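(* Let $q$ be a power of an odd prime, let $\lambda\in\mathbb{F}_q$ be a non-square, and let $f\in\mathbb{F}_q[X]$ be a permutation polynomial of $\mathbb{F}_q$. Then every (weakly) connected component of $\mathcal{G}(\lambda,f)$ has a Hamiltonian cycle, i.e. a directed cycle passing through every vertex of the component exactly once.
   Context: For a polynomial $f\in\mathbb{F}_q[X]$ and a non-square $\lambda\in\mathbb{F}_q$, $\mathcal{G}(\lambda,f)$ is the directed graph whose vertex set is $\mathbb{F}_q$, with an edge from $x$ to $y$ if and only if $(y^2-f(x))(\lambda y^2-f(x))=0$; loops are allowed. *)

(* Defs.v *)
From mathcomp Require Import all_boot all_order all_algebra.

Set Implicit Arguments.
Unset Strict Implicit.
Unset Printing Implicit Defensive.

Import GRing.Theory.
Local Open Scope ring_scope.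

Definition is_square (F : finFieldType) (a : F) : Prop :=
  exists u : F, a = u ^+ 2.

Definition permutation_poly (F : finFieldType) (f : {poly F}) : Prop :=
  bijective (fun x : F => f.[x]).

Definition Ggraph (F : finFieldType) (lambda : F) (f : {poly F}) : rel F :=
  [rel x y : F | (y ^+ 2 - f.[x]) * (lambda * y ^+ 2 - f.[x]) == 0].

Definition weak_connect (T : finType) (e : rel T) : rel T :=
  connect [rel x y : T | e x y || e y x].

Definition weak_components (T : finType) (e : rel T) : {set {set T}} :=
  [set [set y | weak_connect e x y] | x : T].

(* Since [c] is closed up by an edge from its last item to its first, a loop
   is a cycle of length 1 and a pair of opposite edges a cycle of length 2. *)
Definition hamiltonian_cycle (T : finType) (e : rel T) (C : {set T}) (c : seq T) :
    Prop :=
  [/\ (0 < size c)%N, cycle e c, uniq c & c =i C].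

(* Main.v *)
Require Import Defs.
From mathcomp Require Import all_boot all_order all_fingroup all_algebra.

Set Implicit Arguments.
Unset Strict Implicit.
Unset Printing Implicit Defensive.

Import GRing.Theory.
Local Open Scope ring_scope.

(** Since [lambda] is not a square, [y] and [z] have a common in-neighbour only
    if [z = y] or [z = - y], and then all their in-neighbours are common.  Choose
    one element of each pair [{y, - y}] and send the chosen [y] to the
    preimage of [y ^+ 2] under [f], the other one to the preimage of
    [lambda * y ^+ 2]: this permutation assigns an in-neighbour to every
    vertex, so it covers the graph by disjoint directed cycles.  Take such a
    cover with the fewest cycles.  Were there an edge from [a] to [y] between
    distinct cycles, and [z] the successor of [a] in its cycle, then exchanging
    the predecessors of [y] and [z] would merge the two cycles.  Hence the
    cycles of the cover are the weak components. *)

Lemma fconnect_porbit (T : finType) (s : {perm T}) (x y : T) :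
  fconnect s x y = (y \in porbit s x).
Proof.
apply/idP/porbitP => [xy | [i ->]]; last by rewrite permX fconnect_iter.
by exists (findex s x y); rewrite permX iter_findex.
Qed.

Section MinimalCycleCover.

Variables (T : finType) (e : rel T).

Definition cycle_cover (s : {perm T}) : bool := [forall y, e (s y) y].

Hypothesis same_in : forall a y z, e a y -> e a z -> e^~ y =1 e^~ z.

Lemma cycle_cover_merge (s : {perm T}) (y z : T) :
    cycle_cover s -> e (s z) y -> y \notin porbit s z ->
  exists2 t, cycle_cover t & (#|porbits t| < #|porbits s|)%N.
Proof.
move=> /forallP es esz nyz; exists (tperm y z * s)%g.
  apply/forallP=> x; rewrite permM; have eyz := same_in esz (es z).
  by case: tpermP => [->|->|_ _] //; rewrite -eyz.
have neq_yz : y != z by apply: contraNneq nyz => ->; apply: porbit_id.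
(* As [y] and [z] lie in different orbits, the formula says that the new number of orbits plus 2 is
   the old one plus 1. *)
have := porbits_mul_tperm s y z.
by rewrite /= nyz neq_yz addn1 addn2 => -[<-].
Qed.

Lemma min_cycle_cover_closed (s : {perm T}) :
    cycle_cover s ->
    (forall t, cycle_cover t -> (#|porbits s| <= #|porbits t|)%N) ->
  forall a y, e a y -> fconnect s a y.
Proof.
(* [s] runs against the edges, so [z] is the successor of [a] in its cycle. *)
move=> es smin a y; rewrite -[a](permKV s); set z := (s^-1)%g a => ezy.
rewrite -same_fconnect1 ?fconnect_porbit; last exact: perm_inj.
case: (boolP (y \in porbit s z)) => // nyz.
have [t et] := cycle_cover_merge es ezy nyz.
by rewrite ltnNge smin.
Qed.

Lemma cycle_cover_hamiltonian (s : {perm T}) :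
    cycle_cover s ->
  forall C, C \in weak_components e -> exists c, hamiltonian_cycle e C c.
Proof.
move=> es0; have [t /forallP et tmin] := arg_minnP (fun t => #|porbits t|) es0.
(* The orbit lists predecessors; reversing it follows the edges. *)
move=> C /imsetP[x _ ->]; exists (rev (fingraph.orbit t x)); split.
- by rewrite size_rev size_orbit fingraph.order_gt0.
- rewrite rev_cycle; have := cycle_orbit (@perm_inj _ t) x.
  by apply: sub_cycle => y _ /= /eqP <-.
- by rewrite rev_uniq orbit_uniq.
- have closed := min_cycle_cover_closed (introT forallP et) tmin.
  move=> y; rewrite mem_rev -fconnect_orbit inE.
  apply/idP/idP; apply: connect_sub => u v /=.
    by move/eqP <-; apply: connect1; rewrite /= et orbT.
  (* An edge taken backwards stays in the orbit, since reachability under a permutation is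
     symmetric. *)
  case/orP=> /closed //; rewrite fconnect_sym //; exact: perm_inj.
Qed.

End MinimalCycleCover.

Section NonSquare.

Variables (F : finFieldType) (lambda : F) (f : {poly F}).
Hypothesis nsq : ~ is_square lambda.

Lemma nonsquare_neq0 : lambda != 0.
Proof. by apply/eqP=> l0; apply: nsq; exists 0; rewrite l0 expr0n. Qed.

Lemma nonsquare_mul_sqr (y z : F) : y ^+ 2 = lambda * z ^+ 2 -> z = 0.
Proof.
move=> yz; apply/eqP/negPn/negP => z0; apply: nsq; exists (y / z).
by rewrite expr_div_n yz mulfK // expf_neq0.
Qed.

Lemma GgraphE (x y : F) :
  Ggraph lambda f x y = (y ^+ 2 == f.[x]) || (lambda * y ^+ 2 == f.[x]).
Proof. by rewrite /Ggraph /= mulf_eq0 !subr_eq0. Qed.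

Lemma Ggraph_same_in (a y z : F) :
    Ggraph lambda f a y -> Ggraph lambda f a z ->
  (Ggraph lambda f)^~ y =1 (Ggraph lambda f)^~ z.
Proof.
move=> ay az; suff yz : y ^+ 2 = z ^+ 2 by move=> b; rewrite !GgraphE yz.
move: ay az; rewrite !GgraphE => /orP[] /eqP <- /orP[] /eqP // yz.
- have z0 := nonsquare_mul_sqr (esym yz).
  by move: yz; rewrite z0 expr0n mulr0.
- have y0 := nonsquare_mul_sqr yz.
  by move: yz; rewrite y0 expr0n mulr0.
- exact/esym/(mulfI nonsquare_neq0).
Qed.

(** On squares the default [0] never arises, and the root picked is the chosen element of its
    pair. *)
Definition sqrt_of (a : F) : F := odflt 0 [pick r | r ^+ 2 == a].

Lemma sqrt_ofK (y : F) : sqrt_of (y ^+ 2) ^+ 2 = y ^+ 2.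
Proof. by rewrite /sqrt_of; case: pickP => [r /eqP//|/(_ y)]; rewrite eqxx. Qed.

Definition twisted_sqr (y : F) : F :=
  if sqrt_of (y ^+ 2) == y then y ^+ 2 else lambda * y ^+ 2.

(** A chosen and an unchosen element could share a value only if the unchosen one were [0], but [0],
    being its own only root, is chosen. *)
Lemma twisted_sqr_inj : injective twisted_sqr.
Proof.
have other y : sqrt_of (y ^+ 2) != y -> sqrt_of (y ^+ 2) = - y.
  have /eqP := sqrt_ofK y; rewrite eqf_sqr => /orP[/eqP{1}->|/eqP//].
  by rewrite eqxx.
have chosen0 y : y = 0 -> sqrt_of (y ^+ 2) == y.
  by move=> ->; have /eqP := sqrt_ofK 0; rewrite expr0n sqrf_eq0.
move=> y z; rewrite /twisted_sqr.
case: ifPn => cy; case: ifPn => cz.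
- by move=> yz; rewrite -(eqP cy) yz (eqP cz).
- by move/nonsquare_mul_sqr/chosen0; rewrite (negPf cz).
- by move/esym/nonsquare_mul_sqr/chosen0; rewrite (negPf cy).
(* Two unchosen elements with equal squares are both the opposite of the same chosen root. *)
- by move/(mulfI nonsquare_neq0) => yz; apply: oppr_inj; rewrite -other // yz other.
Qed.

Lemma Ggraph_cycle_cover :
  permutation_poly f -> exists s, cycle_cover (Ggraph lambda f) s.
Proof.
case=> g _ gK; have inj := inj_comp (can_inj gK) twisted_sqr_inj.
exists (perm inj); apply/forallP=> y; rewrite permE /= GgraphE gK /twisted_sqr.
by case: ifP; rewrite eqxx ?orbT.
Qed.

End NonSquare.

Theorem theorem2p4 (p k : nat) (F : finFieldType) (lambda : F) (f : {poly F})
  (hp : prime p) (hodd : odd p) (hk : (0 < k)%N) (hF : #|F| = (p ^ k)%N)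
  (hlambda : ~ is_square lambda) (hf : permutation_poly f) :
  forall C : {set F}, C \in weak_components (Ggraph lambda f) ->
    exists c : seq F, hamiltonian_cycle (Ggraph lambda f) C c.
Proof.
have [s es] := Ggraph_cycle_cover hlambda hf.
exact: cycle_cover_hamiltonian (Ggraph_same_in hlambda) _ es.
Qed.
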